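(* Let $n\ge 2$ be an integer. Assume $\Phi^{\ast}:\mathbb{N}\to(0,\infty)$ satisfies $\Phi^{\ast}(t)<t^{-n}$ for all $t\ge t_0$ (for some $t_0$) and $$\liminf_{\alpha\to 1^{+}}\ \liminf_{t\to\infty}\ \frac{\Phi^{\ast}(\alpha t)}{\Phi^{\ast}(t)}\ge 1,$$ where $t$ ranges over $\mathbb{N}$, $\alpha$ over the real numbers greater than $1$, and $\Phi^{\ast}(\alpha t)$ is understood as $\Phi^{\ast}(\lfloor \alpha t\rfloor)$. Then there exist uncountably many $\underline{\xi}\in\mathbb{R}^n$ satisfying $$\limsup_{Q\to\infty}\frac{\psi^{\ast}_{\underline{\xi}}(Q)}{\Phi^{\ast}(Q)}=1,$$ where the limsup is over $Q\in\mathbb{N}$.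
   Context: For $\underline{\xi}=(\xi_1,\ldots,\xi_n)\in\mathbb{R}^n$ and $Q\ge 1$, define $$\psi^{\ast}_{\underline{\xi}}(Q)=\min |b_0+b_1\xi_1+\cdots+b_n\xi_n|,$$ where the minimum is taken over all integer vectors $\underline{b}=(b_0,b_1,\ldots,b_n)\in\mathbb{Z}^{n+1}\setminus\{\underline{0}\}$ with $\max_{1\le i\le n}|b_i|\le Q$ (there is no size restriction on $b_0$). Here $\mathbb{N}$ denotes the positive integers. *)

(* Defs.v *)
From HB Require Import structures.
From mathcomp Require Import all_boot all_order all_algebra.
From mathcomp Require Import all_classical all_reals all_analysis.

Set Implicit Arguments.
Unset Strict Implicit.
Unset Printing Implicit Defensive.

Import Order.TTheory GRing.Theory Num.Theory.
Import numFieldNormedType.Exports.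

Local Open Scope classical_set_scope.
Local Open Scope ring_scope.

(* An integer vector (b_0, b_1, ..., b_n) is a row b : 'rV[int]_n.+1: b_0 is
   b 0 ord0, and b_(i+1) is b 0 (lift ord0 i) for i : 'I_n. *)
Definition linform (R : realType) (n : nat) (xi : 'rV[R]_n)
    (b : 'rV[int]_n.+1) : R :=
  (b 0 ord0)%:~R + \sum_(i < n) (b 0 (lift ord0 i))%:~R * xi 0 i.

(* The entry b_0 is not bounded. *)
Definition admissible (R : realType) (n : nat) (Q : R)
    (b : 'rV[int]_n.+1) : bool :=
  (b != 0) && [forall i : 'I_n, `|b 0 (lift ord0 i)|%:~R <= Q].

(* The infimum is a minimum for Q >= 0: see psi_dual_attained. *)
Definition psi_dual (R : realType) (n : nat) (xi : 'rV[R]_n) (Q : R) : R :=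
  inf [set `|linform xi b| | b in [set b | admissible Q b]].

Lemma psi_dual_attained (R : realType) (n : nat) (xi : 'rV[R]_n) (Q : R) :
  0 <= Q ->
  (exists2 b, admissible Q b & psi_dual xi Q = `|linform xi b|) /\
  (forall c, admissible Q c -> psi_dual xi Q <= `|linform xi c|).
Proof.
move=> Q0.
have lbE : has_lbound [set `|linform xi b| | b in [set b | admissible Q b]].
  by exists 0 => _ [b _ <-].
split; last by move=> c Qc; apply: ge_inf => //; exists c.
pose S : R := Q + 1 + \sum_(i < n) Q * `|xi 0 i|.
have S0 : 0 <= \sum_(i < n) Q * `|xi 0 i| by apply: sumr_ge0 => i _; exact: mulr_ge0.
have [K SK] : exists K : nat, S <= K%:R.
  by exists (Num.truncn S).+1; exact: ltW (truncnS_gt S).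
have bounded b : admissible Q b -> `|linform xi b| <= 1 ->
    forall j, `|b 0 j| <= K%:Z.
  move=> /andP[_ /forallP bQ] b1 j.
  rewrite -(ler_int R) (le_trans _ SK)//.
  case: (unliftP ord0 j) => [i ->|->].
    by apply: (le_trans (bQ i)); rewrite /S -addrA lerDl addr_ge0.
  have sumQ : `|\sum_(i < n) (b 0 (lift ord0 i))%:~R * xi 0 i|
      <= \sum_(i < n) Q * `|xi 0 i|.
    apply: (le_trans (ler_norm_sum _ _ _)); apply: ler_sum => i _.
    by rewrite normrM ler_wpM2r// -intr_norm.
  rewrite intr_norm -[X in `|X|](addrK (\sum_(i < n) (b 0 (lift ord0 i))%:~R * xi 0 i)).
  apply: (le_trans (ler_normB _ _)); rewrite /S; apply: lerD => //.
  by apply: (le_trans b1); rewrite lerDr.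
pose g (f : {ffun 'I_n.+1 -> 'I_(K + K).+1}) : 'rV[int]_n.+1 :=
  \row_j ((f j : nat)%:Z - K%:Z).
have gP (b : 'rV[int]_n.+1) : (forall j, `|b 0 j| <= K%:Z) -> exists f, g f = b.
  move=> bK; exists [ffun j => inord (absz (b 0 j + K%:Z))].
  apply/rowP => j; rewrite mxE ffunE.
  have := bK j; rewrite ler_norml => /andP[bl bu].
  have bp : 0 <= b 0 j + K%:Z by rewrite -lerBlDr sub0r.
  rewrite inordK ?gez0_abs ?addrK//.
  by rewrite ltnS -lez_nat gez0_abs// PoszD lerD2r.
pose e : 'rV[int]_n.+1 := \row_j (j == ord0)%:Z.
have Qe : admissible Q e.
  apply/andP; split.
    by apply/eqP => /rowP/(_ ord0); rewrite !mxE.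
  by apply/forallP => i; rewrite mxE normr0.
have e1 : `|linform xi e| = 1.
  rewrite /linform mxE eqxx big1 ?addr0 ?normr1// => i _.
  by rewrite mxE mul0r.
have [f0 f0e] : exists f, g f = e by apply: gP; apply: bounded; rewrite ?e1.
have Pf0 : admissible Q (g f0) by rewrite f0e.
case: (Order.TotalTheory.arg_minP (P := fun f => admissible Q (g f)) (fun f => `|linform xi (g f)|) Pf0).
move=> f Pf fmin; exists (g f) => //.
apply/eqP; rewrite eq_le; apply/andP; split.
  by apply: ge_inf => //; exists (g f).
apply: lb_le_inf; first by exists `|linform xi e|; exists e.
move=> _ [c Qc <-]; have [c1|c1] := leP `|linform xi c| 1.
  have [h hc] := gP _ (bounded _ Qc c1).
  by rewrite -hc; apply: fmin; rewrite hc.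
by rewrite (le_trans (fmin _ Pf0))// f0e e1 ltW.
Qed.

(* Main.v *)
Require Import Defs.
From HB Require Import structures.
From mathcomp Require Import all_boot all_order all_algebra.
From mathcomp Require Import all_classical all_reals all_analysis.
From mathcomp Require Import zify ring lra.

Set Implicit Arguments.
Unset Strict Implicit.
Unset Printing Implicit Defensive.

Import Order.TTheory GRing.Theory Num.Theory.
Import numFieldNormedType.Exports.

Local Open Scope classical_set_scope.
Local Open Scope ring_scope.

(** The point [xi] is the limit of rational points [p / q], where [q] is the
    common denominator.  If no nonzero integer vector [b] of height
    [max |b_l|, l >= 1] below [X] is orthogonal to [(q, p)], then all these
    forms take values at least [1 / q] at [p / q].  If moreover some vector [c]
    of height [d < X] satisfies [c . (q, p) = 1], then [psi (Q) = 1 / q] exactly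
    for [d <= Q < X], and nearly so on a small box around [p / q].  So [q] has
    to be chosen close to [1 / m], where [m] is the minimum of [Phi] on [[d, X[]:
    this gives [psi <= (1 + eps) Phi] on the whole window and
    [psi >= (1 - eps) Phi] at the argument where the minimum is attained.  If the
    next window starts at [X], the windows cover all large [Q].

    Each [c] is supported on the constant coordinate and one direction [i]: it is
    [(- a, d)], where [a / d] is the reduced form of [p_i / q].  The next
    point [p' / q'] is built as follows ([next_vector]).  Take pairwise coprime
    moduli [e_l], [l != i], of nearly equal size, the smallest being [X], and
    fractions [A_l / e_l] near [p_l / q] in lowest terms.  Put
    [q' = g * prod e_l], [p'_l / q' = A_l / e_l] for [l != i], and
    [p'_i = (1 + a q') / d], so that [c . (q', p') = 1].
    A form vanishing at [p' / q'] has coefficient divisible by [g] in direction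
    [i]; if this coefficient is zero, all others are divisible by the [e_l]
    ([no_short_relation]).  Hence the height of such a form is at least [X] as
    soon as [g >= X].  The direction carrying the modulus [X] is used at the next
    step, with [c' = (- A_j, X)].

    The multiplier [g] is constrained only by [g >= X] and a congruence
    modulo [d], which is fixed, so [q'] can approximate every real number from
    about [X ^ n] on with small relative error ([choose_multiplier]).  Now
    [1 / m] is in this range, because [m <= Phi (X - 1) < (X - 1) ^ - n].  Here
    [n >= 2] provides the second direction.

    For uncountability, any sequence of points can be avoided by making the
    [k]-th box miss its [k]-th term; this is possible unless that term is the
    rational center itself, and at rational points [psi] eventually vanishes,
    so that the upper limit there is 0. *)

(** * Coprimality and short relations *)

Lemma exists_residue (G g0 d : nat) : (0 < d)%N ->
  exists g, [/\ (G <= g)%N, (g <= G + d)%N & g = g0 %[mod d]].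
Proof.
move=> d0; exists (G + (g0 + G * d.-1) %% d)%N; split; first exact: leq_addr.
  by rewrite leq_add2l ltnW// ltn_mod.
rewrite modnDmr addnCA -{1}(muln1 G) -mulnDr add1n prednK//.
by rewrite addnC modnMDl.
Qed.

Lemma exists_neg_inverse (a d : nat) : (0 < d)%N -> coprime a d ->
  exists g0, (d %| (a * g0).+1)%N.
Proof.
move=> d0 ad; have [g0 _] := Bezoutl a d0.
rewrite gcdnC (eqP ad) add1n => dg; by exists g0; rewrite mulnC.
Qed.

Lemma coprime_succ_mul (t K : nat) : coprime (t * K).+1%N K.
Proof. by rewrite -addn1 /coprime gcdnC gcdnMDl gcdn1. Qed.

(** Two such terms differ by a multiple of [K], whose cofactor is at most [n]
    and hence divides [K]. *)
Lemma coprime_progression (n K s l m : nat) : (n`! %| K)%N ->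
  (l < m)%N -> (m - l <= n)%N ->
  coprime ((s + l) * K).+1%N ((s + m) * K).+1%N.
Proof.
move=> nK lm mln.
have -> : ((s + m) * K).+1 = (((s + l) * K).+1 + (m - l) * K)%N by nia.
rewrite /coprime gcdnDl -/(coprime _ _) coprimeMr coprime_succ_mul andbT.
apply: (@coprime_dvdr _ K); last exact: coprime_succ_mul.
by apply: dvdn_trans nK; apply: dvdn_fact; rewrite subn_gt0 lm.
Qed.

Lemma small_coprime_multiple_eq0 (a c : nat) (e : int) (d : nat) : coprime d a -> coprime d c ->
  (d%:Z %| e * (a%:Z * c%:Z))%Z -> (`|e| < d%:Z)%R -> e = 0.
Proof.
move=> da dc; rewrite dvdzE !abszM !absz_nat => h ed.
rewrite Gauss_dvdl in h; last by rewrite coprimeMr da dc.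
apply/eqP; rewrite -absz_eq0; apply: contraTT h; rewrite -lt0n => e0.
by rewrite gtnNdvd//; lia.
Qed.

(** Modulo [g] the relation leaves only the term of direction [i]; modulo
    [g * d l] it leaves only the term of direction [l]. *)
Lemma no_short_relation (n : nat) (i : 'I_n) (g : nat) (d a p : 'I_n -> nat)
    (b : 'rV[int]_n.+1) :
  let q := (g * \prod_(l < n | l != i) d l)%N in
  (0 < q)%N ->
  (forall l, l != i ->
     p l = a l * (g * \prod_(m < n | (m != i) && (m != l)) d m)) %N ->
  coprime (p i) q ->
  (forall l, l != i -> coprime (d l) (a l)) ->
  (forall l m, l != i -> m != i -> l != m -> coprime (d l) (d m)) ->
  b 0 ord0 * q%:Z + \sum_(l < n) b 0 (lift ord0 l) * (p l)%:Z = 0 ->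
  `|b 0 (lift ord0 i)| < g%:Z ->
  (forall l, l != i -> `|b 0 (lift ord0 l)| < (d l)%:Z) ->
  b = 0.
Proof.
move=> q q0 pE pq da dd rel big bld.
have g0 : (0 < g)%N by move: q0; rewrite /q muln_gt0 => /andP[].
have bi0 : b 0 (lift ord0 i) = 0.
  apply: (@small_coprime_multiple_eq0 (p i) 1%N _ g _ _ _ big); rewrite ?coprimen1//.
    by rewrite coprime_sym; apply: coprime_dvdr pq; apply: dvdn_mulr.
  rewrite mulr1; move: rel; rewrite (bigD1 i)//= addrCA => /eqP.
  rewrite addr_eq0 => /eqP ->; rewrite rpredN rpredD//.
    by apply: dvdz_mull; rewrite dvdzE !absz_nat dvdn_mulr.
  apply: rpred_sum => l li; apply: dvdz_mull; rewrite dvdzE !absz_nat pE//.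
  by apply: dvdn_mull; apply: dvdn_mulr.
have bl0 l : l != i -> b 0 (lift ord0 l) = 0.
  move=> li; set P := (\prod_(m < n | (m != i) && (m != l)) d m)%N.
  apply: (@small_coprime_multiple_eq0 (a l) P _ (d l) (da l li) _ _ (bld l li)).
    by apply: (big_ind (fun x => coprime (d l) x)) => [|x y dx dy|m /andP[mi ml]];
       rewrite ?coprimen1 ?coprimeMr ?dx ?dd// eq_sym.
  have qE : q = (g * (d l * P))%N by rewrite /q (bigD1 l).
  suff : b 0 (lift ord0 l) * (p l)%:Z \in dvdz (g * d l)%N%:Z.
    have -> : b 0 (lift ord0 l) * (p l)%:Z =
      g%:Z * (b 0 (lift ord0 l) * ((a l)%:Z * P%:Z)) by rewrite pE// -/P; lia.
    by rewrite PoszM dvdz_mul2l; case: (g) g0.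
  move: rel; rewrite (bigD1 l)//= addrCA => /eqP.
  rewrite addr_eq0 => /eqP ->; rewrite rpredN rpredD//.
    by apply: dvdz_mull; rewrite dvdzE !absz_nat qE mulnA dvdn_mulr.
  apply: rpred_sum => m ml; have [->|mi] := eqVneq m i; first by rewrite bi0 mul0r rpred0.
  apply: dvdz_mull; rewrite dvdzE !absz_nat pE//; apply: dvdn_mull.
  by rewrite dvdn_pmul2l// (bigD1 l)/= ?dvdn_mulr// li eq_sym.
have b0 : b 0 ord0 = 0.
  move: rel; rewrite big1 ?addr0 => [/eqP|l _].
    by rewrite mulf_eq0 => /orP[/eqP //|]; rewrite eqz_nat => /eqP qe; move: q0; rewrite qe.
  by have [->|/bl0->] := eqVneq l i; rewrite ?bi0 mul0r.
apply/rowP => j; rewrite mxE; case: (unliftP ord0 j) => [l ->|->//].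
by have [->|/bl0] := eqVneq l i.
Qed.

(** The factors of [K] serve three purposes: [n`!] makes the moduli [e l] pairwise
    coprime, [\prod p l] makes each [A l] coprime to [e l], and [q] turns
    [p l / q * ((s + l) * K)] into the integer [A l].  Since [d] divides [q], each
    [e l] is 1 modulo [d], so the congruence on [a * g] passes to [a * q']. *)
Lemma next_vector (n : nat) (i : 'I_n) (q d a s g : nat) (p : 'I_n -> nat) :
  let K := (n`! * (q * \prod_(l < n) p l))%N in
  let e (l : nat) := ((s + l) * K).+1 in
  let A (l : 'I_n) := (p l * (n`! * \prod_(m < n) p m) * (s + l))%N in
  let q' := (g * \prod_(l < n | l != i) e l)%N in
  (0 < q)%N -> (forall l, 0 < p l)%N -> (0 < d)%N ->
  (p i * d = a * q)%N -> coprime a d -> (0 < s)%N -> (0 < g)%N ->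
  (d %| (a * g).+1)%N ->
  exists p' : 'I_n -> nat,
    [/\ forall l, (0 < p' l)%N,
        (p' i * d = (a * q').+1)%N,
        forall l, l != i -> (p' l * e l = A l * q')%N,
        forall l, coprime (A l) (e l) &
        forall b : 'rV[int]_n.+1,
          b 0 ord0 * q'%:Z + \sum_(l < n) b 0 (lift ord0 l) * (p' l)%:Z = 0 ->
          `|b 0 (lift ord0 i)| < g%:Z ->
          (forall l : 'I_n, l != i -> `|b 0 (lift ord0 l)| < (e l)%:Z) ->
          b = 0].
Proof.
move=> K e A q' q0 p0 d0 pd ad s0 g0 dag.
have dK : (d %| K)%N.
  apply/dvdn_mull/dvdn_mulr; rewrite -(@Gauss_dvdr _ a) 1?coprime_sym//.
  by rewrite -pd dvdn_mull.
have e1 l : e l = 1 %[mod d].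
  by rewrite /e -addn1 -modnDml -modnMmr (eqP dK) muln0 mod0n.
have D1 : (\prod_(l < n | l != i) e l = 1 %[mod d])%N.
  by apply: (big_ind (fun x => x = 1 %[mod d])) => // x y x1 y1;
     rewrite -modnMm x1 y1 modnMm.
have dq' : (d %| (a * q').+1)%N.
  rewrite /q' mulnA /dvdn -addn1 -modnDml -modnMmr D1 modnMmr modnDml muln1.
  by rewrite addn1 -/(dvdn _ _).
have q'0 : (0 < q')%N by rewrite muln_gt0 g0 prodn_gt0.
have Ae l : coprime (A l) (e l).
  apply: (@coprime_dvdl _ (((s + l) * K) * ((s + l) * K))%N); last first.
    by rewrite coprimeMl /e coprimenS.
  have pP : (\prod_(m < n) p m %| K)%N by apply/dvdn_mull/dvdn_mull.
  rewrite /A -mulnA; apply: dvdn_mul.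
    by apply/dvdn_mull/(dvdn_trans _ pP); rewrite (bigD1 l)//= dvdn_mulr.
  by rewrite mulnC dvdn_mul// dvdn_mul// dvdn_mull.
pose p' l := if l == i then ((a * q').+1 %/ d)%N
  else (A l * (g * \prod_(m < n | (m != i) && (m != l)) e m))%N.
have p'i : (p' i * d = (a * q').+1)%N by rewrite /p' eqxx divnK.
exists p'; split=> //.
- move=> l; rewrite /p'; case: eqP => _.
    by rewrite divn_gt0// dvdn_leq.
  by rewrite !muln_gt0 !p0 fact_gt0 addn_gt0 s0 g0 !prodn_gt0.
- move=> l li; rewrite /p' (negbTE li) /q' [X in _ = (_ * (_ * X))%N](bigD1 l)//=.
  by rewrite -!mulnA [(_ * e l)%N]mulnC.
- move=> b rel; apply: (no_short_relation q'0 _ _ _ _ rel).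
  + by move=> l li; rewrite /p' (negbTE li).
  + apply: (@coprime_dvdl _ (p' i * d)%N); first exact: dvdn_mulr.
    rewrite p'i; apply: (@coprime_dvdr _ (a * q')%N); first exact: dvdn_mull.
    exact: coprimeSn.
  + by move=> l _; rewrite coprime_sym.
  + move=> l m _ _; have nK : (n`! %| K)%N by exact: dvdn_mulr.
    have lt (u v : 'I_n) : (u < v)%N -> coprime (e u) (e v).
      by move=> uv; apply: (@coprime_progression n K s u v nK uv); have := ltn_ord v; lia.
    rewrite neq_ltn => /orP[/lt//|/lt]; by rewrite coprime_sym.
Qed.

(** * The minimal function near a rational point *)

Lemma linform_dist (R : realType) (n : nat) (xi eta : 'rV[R]_n)
    (b : 'rV[int]_n.+1) (m r : R) :
  (forall l, `|b 0 (lift ord0 l)|%:~R <= m) ->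
  (forall l, `|xi 0 l - eta 0 l| <= r) ->
  `|linform xi b - linform eta b| <= n%:R * (m * r).
Proof.
move=> bm xr; rewrite /linform opprD addrACA subrr add0r -sumrB.
apply: (le_trans (ler_norm_sum _ _ _)).
rewrite -[n in n%:R]card_ord -sum1_card natr_sum mulr_suml; apply: ler_sum => l _.
by rewrite mul1r -mulrBr normrM ler_pM// -intr_norm.
Qed.

Definition rational_point (R : realType) (n : nat) (q : nat)
    (p : 'I_n -> nat) : 'rV[R]_n := \row_l ((p l)%:R / q%:R).

Lemma linform_rational (R : realType) (n q : nat) (p : 'I_n -> nat)
    (b : 'rV[int]_n.+1) : (0 < q)%N ->
  linform (rational_point R q p) b =
  (b 0 ord0 * q%:Z + \sum_(l < n) b 0 (lift ord0 l) * (p l)%:Z)%:~R / q%:R.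
Proof.
move=> q0; have qn0 : (q%:R : R) != 0 by rewrite pnatr_eq0 -lt0n.
rewrite rmorphD rmorphM/= mulrDl mulfK// rmorph_sum mulr_suml /linform.
by congr (_ + _); apply: eq_bigr => l _; rewrite mxE rmorphM/= mulrA.
Qed.

Lemma admissible_lt (R : realType) (n Q X : nat) (b : 'rV[int]_n.+1) :
  (Q < X)%N -> admissible (Q%:R : R) b ->
  b != 0 /\ forall l, `|b 0 (lift ord0 l)| < X%:Z.
Proof.
move=> QX /andP[b0 /forallP bQ]; split=> // l.
rewrite (@le_lt_trans _ _ Q%:Z) ?ltz_nat//.
by have := bQ l; rewrite -[Q%:R]/(Q%:Z%:~R) ler_int.
Qed.

(** On the box every form of height below [X] keeps the value it has at the
    rational point, up to [e / q]; there it is a nonzero multiple of [1 / q],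
    and [(- a, d)] realises [1 / q] itself. *)
Lemma psi_near_rational (R : realType) (n : nat) (xi : 'rV[R]_n) (i : 'I_n)
    (q a d X : nat) (p : 'I_n -> nat) (e r : R) :
  (0 < q)%N -> (0 < d)%N -> (p i * d = (a * q).+1)%N ->
  (forall b : 'rV[int]_n.+1,
     b 0 ord0 * q%:Z + \sum_(l < n) b 0 (lift ord0 l) * (p l)%:Z = 0 ->
     (forall l, `|b 0 (lift ord0 l)| < X%:Z) -> b = 0) ->
  (forall l, `|xi 0 l - (p l)%:R / q%:R| <= r) ->
  n%:R * (X%:R * r) <= e / q%:R ->
  forall Q, (d <= Q < X)%N ->
    (1 - e) / q%:R <= psi_dual xi Q%:R <= (1 + e) / q%:R.
Proof.
move=> q0 d0 pd norel xr rE Q /andP[dQ QX].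
have qR : 0 < (q%:R : R) by rewrite ltr0n.
have near b : admissible (Q%:R : R) b ->
    `|linform xi b - linform (rational_point R q p) b| <= e / q%:R.
  move=> /(admissible_lt QX)[_ bX]; apply: le_trans rE; apply: linform_dist.
    by move=> l; rewrite -[X%:R]/(X%:Z%:~R) ler_int ltW.
  by move=> l; rewrite mxE.
have [[b bQ ->] psi_le] := psi_dual_attained xi (ler0n R Q).
apply/andP; split.
  have [b0 bX] := admissible_lt QX bQ.
  have : 1 / q%:R <= `|linform (rational_point R q p) b|.
    rewrite linform_rational// normrM normfV (gtr0_norm qR) ler_pM2r ?invr_gt0//.
    rewrite -intr_norm ler1z -gtz0_ge1 normr_gt0.
    by apply: contra b0 => /eqP/norel/(_ bX)->.
  have := near _ bQ; rewrite distrC.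
  have := lerB_dist (linform (rational_point R q p) b) (linform xi b).
  by rewrite mulrBl; lra.
pose c : 'rV[int]_n.+1 := \row_j
  if unlift ord0 j is Some l then (if l == i then d%:Z else 0) else - a%:Z.
have c0 : c 0 ord0 = - a%:Z by rewrite mxE unlift_none.
have cl l : c 0 (lift ord0 l) = if l == i then d%:Z else 0 by rewrite mxE liftK.
have cQ : admissible (Q%:R : R) c.
  apply/andP; split; last first.
    apply/forallP => l; rewrite cl; case: ifP => _.
      by rewrite (ger0_norm (_ : 0 <= d%:Z))// -pmulrn ler_nat.
    by rewrite normr0 ler0n.
  apply/eqP => /rowP/(_ (lift ord0 i)); rewrite cl eqxx mxE => /eqP.
  by rewrite eqz_nat => /eqP dz; rewrite dz in d0.
apply: (le_trans (psi_le _ cQ)).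
have cE : linform (rational_point R q p) c = 1 / q%:R.
  rewrite linform_rational// (bigD1 i)//= big1 => [|l /negbTE li]; last first.
    by rewrite cl li mul0r.
  have -> : c 0 ord0 * q%:Z + (c 0 (lift ord0 i) * (p i)%:Z + 0) = 1.
    by rewrite c0 cl eqxx; lia.
  by [].
have := near _ cQ; rewrite cE.
have := lerB_dist (linform xi c) (1 / q%:R).
rewrite [X in _ - X <= _ -> _]gtr0_norm; first by rewrite mulrDl; lra.
by rewrite divr_gt0.
Qed.

(** * The size of the next denominator *)

Lemma ler_expn_shift (R : realType) (n : nat) (B e : R) : 0 <= B -> 0 < e ->
  exists S0 : nat, forall y : R, S0%:R <= y -> (y + B) ^+ n <= (1 + e) * y ^+ n.
Proof.
move=> B0; elim: n e => [|n IH] e e0.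
  by exists 0%N => y _; rewrite !expr0; lra.
pose f := Num.min e 1 / 3%:R.
have f0 : 0 < f by rewrite divr_gt0// lt_min e0 ltr01.
have fe : (1 + f) * (1 + f) <= 1 + e.
  have : Num.min e 1 <= e by rewrite ge_min lexx.
  have : Num.min e 1 <= 1 by rewrite ge_min lexx orbT.
  have -> : Num.min e 1 = 3%:R * f by rewrite /f mulrC divfK// pnatr_eq0.
  by nra.
have [S0 S0P] := IH f f0; exists (S0 + (Num.truncn (B / f)).+1)%N => y Sy.
have y0 : 0 <= y by apply: le_trans Sy; rewrite ler0n.
have S0y : S0%:R <= y by apply: le_trans Sy; rewrite ler_nat leq_addr.
have By : B <= f * y.
  rewrite mulrC -ler_pdivrMr//; apply: (le_trans (ltW (truncnS_gt _))).
  by apply: le_trans Sy; rewrite ler_nat leq_addl.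
rewrite !exprS; apply: (@le_trans _ _ (((1 + f) * y) * ((1 + f) * y ^+ n))).
  by apply: ler_pM; rewrite ?exprn_ge0 ?addr_ge0 ?S0P//; lra.
rewrite mulrACA; apply: ler_wpM2r => //.
by rewrite mulr_ge0 ?exprn_ge0.
Qed.

(** The multiplier is taken within a bounded distance above the larger of [y.+1]
    and [1 / (m * D)].  If [y.+1] is the larger then [m * y ^ n.+1 <= 1] keeps
    the product small; the bounded error, at most [B], is absorbed by the growth
    hypothesis in both cases. *)
Lemma choose_multiplier (R : realType) (n : nat) (m e : R) (y B D d g0 : nat) :
  0 < m -> (0 < d)%N -> (0 < D)%N ->
  (D <= (y + B) ^ n)%N -> (d + 2 <= B)%N ->
  m * y%:R ^+ n.+1 <= 1 -> (y + B)%:R ^+ n.+1 <= (1 + e) * y%:R ^+ n.+1 :> R ->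
  0 < e ->
  exists g, [/\ (y < g)%N, g = g0 %[mod d], 1 <= m * (g * D)%:R &
    m * (g * D)%:R <= 1 + e].
Proof.
move=> m0 d0 D0 DB dB my yB e0.
have DR : 0 < (D%:R : R) by rewrite ltr0n.
have mD : 0 < m * D%:R by rewrite mulr_gt0.
pose T := Num.truncn (m * D%:R)^-1.
have [g [Gg gG gm]] := exists_residue (maxn y.+1 T.+1) g0 d0.
exists g; split=> //.
- by apply: leq_trans Gg; rewrite leq_max leqnn.
- have Tg : (m * D%:R)^-1 <= g%:R.
    apply: (le_trans (ltW (truncnS_gt _))); rewrite ler_nat.
    by apply: leq_trans Gg; rewrite leq_max leqnn orbT.
  by rewrite natrM mulrCA -ler_pdivrMr// mul1r.
have DBR : (D%:R : R) <= (y + B)%:R ^+ n by rewrite -natrX ler_nat.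
have yR : 0 <= (y%:R : R) := ler0n R y.
have BR : 0 <= (B%:R : R) := ler0n R B.
have big0 : 0 <= ((y + B)%:R : R) ^+ n by rewrite exprn_ge0// ler0n.
have mz z : z <= (1 + e) * y%:R ^+ n.+1 -> m * z <= 1 + e.
  move=> ze; apply: (le_trans (ler_wpM2l (ltW m0) ze)).
  by rewrite mulrCA -[leRHS]mulr1 ler_wpM2l//; lra.
have [yT|Ty] := leqP y.+1 T.+1; last first.
  apply: mz; apply: le_trans yB; rewrite natrM exprS; apply: ler_pM => //.
  by rewrite ler_nat; move: gG; rewrite (maxn_idPl (ltnW Ty)); lia.
have gT : g%:R <= (m * D%:R)^-1 + B%:R.
  apply: (@le_trans _ _ (T%:R + B%:R)).
    by rewrite -natrD ler_nat; move: gG; rewrite (maxn_idPr yT); lia.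
  by rewrite lerD2r truncn_le// invr_ge0 ltW.
have BD : B%:R * D%:R <= e * y%:R ^+ n.+1.
  have : B%:R * D%:R <= B%:R * (y + B)%:R ^+ n :> R by rewrite ler_wpM2l.
  have : y%:R ^+ n <= (y + B)%:R ^+ n :> R.
    by rewrite lerXn2r ?nnegrE// ler_nat leq_addr.
  by move: yB; rewrite !exprS natrD; nra.
rewrite natrM mulrCA; apply: (le_trans (ler_wpM2r (ltW mD) gT)).
rewrite mulrDl mulVf ?gt_eqF// lerD2l mulrCA.
apply: (le_trans (ler_wpM2l (ltW m0) BD)).
by rewrite mulrCA -[leRHS]mulr1 ler_wpM2l// ltW.
Qed.

(** * Refining a box *)

(** One step of the construction: the rational point [num / den], the direction
    in which the current short form lives, the reduced fraction
    [rnum / rden = num dir / den] which gives this form as [(- rnum, rden)], and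
    the radius of the box to which the limit is confined. *)
Record node (R : realType) (n : nat) := Node {
  den : nat;
  num : 'I_n -> nat;
  dir : 'I_n;
  rnum : nat;
  rden : nat;
  rad : R;
  den_gt0 : (0 < den)%N;
  num_gt0 : forall l, (0 < num l)%N;
  rden_gt0 : (0 < rden)%N;
  num_dir : (num dir * rden = rnum * den)%N;
  coprime_red : coprime rnum rden;
  rad_gt0 : 0 < rad }.

Definition in_box (R : realType) (n : nat) (v : node R n) (xi : 'rV[R]_n) :=
  forall l, `|xi 0 l - (num v l)%:R / (den v)%:R| <= rad v.

(** Linear dependence of [1, xi_1, .., xi_n] over the integers: the obstruction to
    avoiding a point. *)
Definition integrally_dependent (R : realType) (n : nat) (xi : 'rV[R]_n) :=
  exists2 b : 'rV[int]_n.+1, b != 0 & linform xi b = 0.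

Lemma rational_point_dependent (R : realType) (n : nat) (i : 'I_n) (q : nat)
    (p : 'I_n -> nat) : (0 < q)%N -> integrally_dependent (rational_point R q p).
Proof.
move=> q0; pose b : 'rV[int]_n.+1 := \row_j
  if unlift ord0 j is Some l then (if l == i then q%:Z else 0) else - (p i)%:Z.
have b0 : b 0 ord0 = - (p i)%:Z by rewrite mxE unlift_none.
have bl l : b 0 (lift ord0 l) = if l == i then q%:Z else 0 by rewrite mxE liftK.
exists b.
  apply/eqP => /rowP/(_ (lift ord0 i)); rewrite bl eqxx mxE => /eqP.
  by rewrite eqz_nat => /eqP qz; rewrite qz in q0.
rewrite linform_rational// (bigD1 i)//= big1 => [|l /negbTE li]; last first.
  by rewrite bl li mul0r.
by rewrite b0 bl eqxx addr0 mulNr [X in - X]mulrC addNr mul0r.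
Qed.

(** A point which is not the center of the box leaves it when the radius shrinks;
    the center is rational, hence dependent. *)
Lemma exists_radius (R : realType) (n : nat) (i : 'I_n) (q : nat)
    (p : 'I_n -> nat) (zeta : 'rV[R]_n) (r0 : R) : (0 < q)%N -> 0 < r0 ->
  exists r, [/\ 0 < r, r <= r0 &
    (forall l, `|zeta 0 l - (p l)%:R / q%:R| <= r) ->
    integrally_dependent zeta].
Proof.
move=> q0 r00; have [->|ne] := eqVneq zeta (rational_point R q p).
  by exists r0; split=> // _; exact: rational_point_dependent.
have [l zl] : exists l, zeta 0 l != (p l)%:R / q%:R.
  apply/existsP; rewrite -negb_forall; apply: contra ne => /forallP zE.
  by apply/eqP/rowP => l; rewrite mxE; apply/eqP/zE.
have gap : 0 < `|zeta 0 l - (p l)%:R / q%:R| by rewrite normr_gt0 subr_eq0.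
exists (Num.min r0 (`|zeta 0 l - (p l)%:R / q%:R| / 2)); split.
- by rewrite lt_min r00 divr_gt0.
- by rewrite ge_min lexx.
- by move=> /(_ l); rewrite le_min => /andP[_]; lra.
Qed.

(** By [A * q = p * e] the displacement is exactly [p / (q * e.+1)]. *)
Lemma center_dist_other (R : realType) (q p e p' q' A : nat) : (0 < q)%N ->
  (0 < q')%N -> (A * q = p * e)%N -> (p' * e.+1 = A * q')%N ->
  `|p'%:R / q'%:R - p%:R / q%:R| <= p%:R / e.+1%:R :> R.
Proof.
move=> q0 q'0 AE p'E.
have qR : 1 <= (q%:R : R) by rewrite ler1n.
have qn0 : (q%:R : R) != 0 by rewrite pnatr_eq0 -lt0n.
have q'n0 : (q'%:R : R) != 0 by rewrite pnatr_eq0 -lt0n.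
have eR : 0 < (e.+1%:R : R) by rewrite ltr0n.
have p'R : p'%:R / q'%:R = A%:R / e.+1%:R :> R.
  by apply/eqP; rewrite (eqr_div _ _ q'n0 (lt0r_neq0 eR)) -natrM p'E natrM.
have AR : A%:R = p%:R * e%:R / q%:R :> R.
  by rewrite -natrM -AE natrM mulfK.
have -> : p'%:R / q'%:R - p%:R / q%:R = - (p%:R / e.+1%:R / q%:R) :> R.
  rewrite p'R AR -natr1; field.
  by rewrite qn0 natr1 gt_eqF.
rewrite normrN ger0_norm ?divr_ge0// ler_pdivrMr//; last by rewrite ltr0n.
by rewrite ler_peMr// divr_ge0.
Qed.

(** Both fractions have denominator [d] up to the added unit, so the displacement
    is exactly [1 / (d * q')]. *)
Lemma center_dist_dir (R : realType) (q p d p' q' a : nat) : (0 < q)%N ->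
  (0 < q')%N -> (0 < d)%N -> (p * d = a * q)%N -> (p' * d = (a * q').+1)%N ->
  `|p'%:R / q'%:R - p%:R / q%:R| <= 1 / q'%:R :> R.
Proof.
move=> q0 q'0 d0 pE p'E.
have qn0 : (q%:R : R) != 0 by rewrite pnatr_eq0 -lt0n.
have q'R : 0 < (q'%:R : R) by rewrite ltr0n.
have dn0 : (d%:R : R) != 0 by rewrite pnatr_eq0 -lt0n.
have pR : p%:R / q%:R = a%:R / d%:R :> R.
  by apply/eqP; rewrite (eqr_div _ _ qn0 dn0) -natrM pE natrM.
have p'R : p'%:R = (a%:R * q'%:R + 1) / d%:R :> R.
  by rewrite -natrM natr1 -p'E natrM mulfK.
have -> : p'%:R / q'%:R - p%:R / q%:R = 1 / q'%:R / d%:R :> R.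
  rewrite pR p'R; field.
  by rewrite dn0 gt_eqF.
rewrite ger0_norm ?divr_ge0// ler_pdivrMr ?ltr0n//.
by rewrite ler_peMr ?divr_ge0// ler1n.
Qed.

Lemma exists_argmin_nat (R : realType) (f : nat -> R) (a b : nat) : (a < b)%N ->
  exists Q0, (a <= Q0 < b)%N /\ forall Q, (a <= Q < b)%N -> f Q0 <= f Q.
Proof.
move=> ab.
case: (Order.TotalTheory.arg_minP (P := fun k : 'I_b => (a <= k)%N)
  (fun k : 'I_b => f k) (i0 := Ordinal ab)) => // k ak kmin.
exists k; split=> [|Q /andP[aQ Qb]]; first by rewrite ak ltn_ord.
exact: (kmin (Ordinal Qb)).
Qed.

Lemma exists_min_index_neq (n : nat) (i : 'I_n) : (2 <= n)%N ->
  exists2 j : 'I_n, j != i & forall l : 'I_n, l != i -> (j <= l)%N.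
Proof.
case: n i => [|[|n]]// i _; have [->|i0] := eqVneq i ord0; last by exists ord0; rewrite // eq_sym.
exists (lift ord0 ord0) => // l; rewrite -(inj_eq val_inj) /= /bump/=; lia.
Qed.

Lemma prod_except_le (n : nat) (i : 'I_n) (e : 'I_n -> nat) (M : nat) :
  (forall l, e l <= M)%N -> (\prod_(l < n | l != i) e l <= M ^ n.-1)%N.
Proof.
move=> eM; apply: (@leq_trans (\prod_(l < n | l != i) M)%N).
  by apply: leq_prod => l _.
by rewrite prod_nat_const cardC1 card_ord.
Qed.

(** The two estimates on [psi_dual] say that [1 / den w] is the minimum [m] of
    [Phi] on the window, up to a factor [1 + eps / 2], and that [psi_dual] is
    [1 / den w] on the window, up to the same relative error. *)
Lemma refine (R : realType) (n : nat) (Phi : nat -> R) (v : node R n)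
    (zeta : 'rV[R]_n) (eps : R) : (2 <= n)%N ->
  (forall t : nat, (0 < t)%N -> 0 < Phi t) ->
  (exists t0 : nat, forall t : nat, (0 < t)%N -> (t0 <= t)%N ->
      Phi t < t%:R ^- n) ->
  0 < eps -> eps <= 1 ->
  exists w : node R n,
    [/\ (rden v < rden w)%N,
        forall l, `|(num w l)%:R / (den w)%:R - (num v l)%:R / (den v)%:R|
                    + rad w <= rad v,
        forall xi, in_box w xi -> forall Q, (rden v <= Q < rden w)%N ->
          psi_dual xi Q%:R <= (1 + eps) * Phi Q,
        forall xi, in_box w xi -> exists2 Q, (rden v <= Q < rden w)%N &
          (1 - eps) * Phi Q <= psi_dual xi Q%:R &
        in_box w zeta -> integrally_dependent zeta].
Proof.
have mulE (x y z t u : nat) : (x * (y * z) * t * u = x * (t * (y * (u * z))))%N by lia.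
move=> hn Phi_gt0 [t0 Phi_lt] eps0 eps1.
case: v => q p i a d r /= q0 p0 d0 pd ad r0.
have [j ji jmin] := exists_min_index_neq i hn.
pose e1 := eps / 2; have e10 : 0 < e1 by rewrite divr_gt0.
pose K := (n`! * (q * \prod_(l < n) p l))%N.
have K0 : (0 < K)%N by rewrite !muln_gt0 fact_gt0 q0 prodn_gt0.
(* [n * K] bounds the spread of the moduli, [d + 2] the rounding of [g]. *)
pose B := (n * K + d + 3)%N.
have [S0 S0P] := ler_expn_shift n (ler0n R B) e10.
pose P := (\sum_(l < n) p l + 1)%N.
(* The summands make the moduli exceed, in turn, the thresholds for the growth
   estimate, for [Phi] and for [d], and make both displacements at most [r / 2]. *)
pose s := (S0 + t0 + d + (Num.truncn (P%:R / (r / 2))).+1)%N.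
have s0 : (0 < s)%N by rewrite /s addnS.
pose e (l : nat) := ((s + l) * K).+1.
pose y := ((s + j) * K)%N; have ejE : e j = y.+1 by [].
have sy : (s <= y)%N by rewrite /y; nia.
pose D := (\prod_(l < n | l != i) e l)%N.
have D0 : (0 < D)%N by rewrite prodn_gt0.
have DB : (D <= (y + B) ^ n.-1)%N.
  apply: prod_except_le => l; have := ltn_ord l.
  by rewrite /e /y /B; nia.
have [yS0 yt0 yd] : [/\ S0 <= y, t0 <= y & d <= y]%N.
  by split; apply: leq_trans sy; rewrite /s; lia.
have y0 : (0 < y)%N := leq_trans s0 sy.
have dej : (d < e j)%N by rewrite ejE ltnS.
have [Q0 [dQ0 Q0min]] := exists_argmin_nat Phi dej.
pose m := Phi Q0.
have m0 : 0 < m by apply: Phi_gt0; apply: leq_trans d0 _; case/andP: dQ0.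
have my : m * y%:R ^+ n <= 1.
  have yn0 : 0 < (y%:R : R) ^+ n by rewrite exprn_gt0// ltr0n.
  rewrite -ler_pdivlMr// div1r; apply: (@le_trans _ _ (Phi y)).
    by apply: Q0min; rewrite ejE ltnSn andbT.
  exact/ltW/Phi_lt.
have [g0 dg0] := exists_neg_inverse d0 ad.
have nE : n.-1.+1 = n := prednK (ltnW hn).
have [g [yg gg0 mg1 mg2]] : exists g, [/\ (y < g)%N, g = g0 %[mod d],
    1 <= m * (g * D)%:R & m * (g * D)%:R <= 1 + e1].
  apply: (choose_multiplier (n := n.-1) (B := B) g0) => //; rewrite ?nE//.
    by rewrite /B -addnA (leq_trans _ (leq_addl _ _))// leq_add2l.
  by rewrite natrD; apply: S0P; rewrite ler_nat.
have dg : (d %| (a * g).+1)%N.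
  by move: dg0; rewrite /dvdn -!(addn1 (a * _)) -modnDml -modnMmr -gg0 modnMmr modnDml.
have g_gt0 : (0 < g)%N := leq_ltn_trans (leq0n y) yg.
have [p' [p'0 p'i p'l Ae rel]] :=
  next_vector q0 p0 d0 pd ad s0 g_gt0 dg.
rewrite -/K -/D in p'i p'l Ae rel.
set q' := (g * D)%N in p'i p'l rel mg1 mg2.
have q'0 : (0 < q')%N by rewrite muln_gt0 g_gt0.
have q'R : 0 < (q'%:R : R) by rewrite ltr0n.
pose gap := e1 / q'%:R / (n%:R * (e j)%:R).
have nej0 : 0 < n%:R * (e j)%:R :> R by rewrite mulr_gt0// ltr0n ltnW.
have gap0 : 0 < gap by rewrite divr_gt0// divr_gt0.
have rmin0 : 0 < Num.min (r / 2) gap by rewrite lt_min gap0 divr_gt0.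
(* [gap] bounds the radius so that the values of short forms move by at most
   [e1 / q']. *)
have [r' [r'0 r'min zr]] := exists_radius i p' zeta q'0 rmin0.
have [r'r r'gap] : r' <= r / 2 /\ r' <= gap.
  by move: r'min; rewrite le_min => /andP[].
exists (@Node R n q' p' j _ (e j) r' q'0 p'0 isT (p'l j ji) (Ae j) r'0).
rewrite /in_box /=.
have small (xi : 'rV[R]_n) : (forall l, `|xi 0 l - (p' l)%:R / q'%:R| <= r') ->
  forall Q, (d <= Q < e j)%N ->
    (1 - e1) / q'%:R <= psi_dual xi Q%:R <= (1 + e1) / q'%:R.
  move=> xr; apply: (psi_near_rational (r := r') q'0 d0 p'i) => //.
    move=> b bz bX; apply: rel => //.
      by apply: (lt_le_trans (bX i)); rewrite lez_nat ejE.
    move=> l li; apply: (lt_le_trans (bX l)); rewrite lez_nat /e ltnS leq_mul2r.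
    by rewrite leq_add2l jmin// orbT.
  by rewrite mulrA mulrC -ler_pdivlMr.
split=> //.
- move=> l.
  have Ps (x : nat) : (x <= P)%N -> forall z : nat, (s <= z)%N -> (0 < z)%N ->
      x%:R / z%:R <= r / 2.
    move=> xP z sz z0; rewrite ler_pdivrMr ?ltr0n// mulrC -ler_pdivrMr ?divr_gt0//.
    apply: (@le_trans _ _ (P%:R / (r / 2))).
      by rewrite ler_wpM2r ?invr_ge0 ?ler_nat// ltW// divr_gt0.
    apply: (le_trans (ltW (truncnS_gt _))); rewrite ler_nat.
    by apply: leq_trans sz; rewrite /s leq_addl.
  rewrite [leRHS](splitr r); apply: lerD => //.
  have [->|li] := eqVneq l i.
    apply: le_trans (center_dist_dir _ q0 q'0 d0 pd p'i) _.
    apply: (Ps 1%N) => //; first by rewrite /P addn1.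
    exact: leq_trans (leq_trans sy (ltnW yg)) (leq_pmulr _ D0).
  apply: le_trans (center_dist_other _ q0 q'0 _ (p'l l li)) _.
    exact: mulE.
  apply: Ps => //; first by rewrite /P (bigD1 l)//= -addnA leq_addr.
  exact/leqW/(leq_trans (leq_addr l s))/leq_pmulr.
- move=> xi /small psi Q Qr; have /andP[_] := psi Q Qr.
  have := Q0min Q Qr; rewrite -/m => mQ psiQ.
  apply: (le_trans psiQ); rewrite ler_pdivrMr//.
  have : m * q'%:R <= Phi Q * q'%:R by rewrite ler_pM2r.
  by rewrite /e1; nra.
- move=> xi /small psi; exists Q0 => //; have /andP[+ _] := psi Q0 dQ0.
  apply: le_trans; rewrite ler_pdivlMr// -/m -mulrA.
  by rewrite /e1 in e10 mg2 *; nra.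
Qed.

(** * The limit point *)

Lemma nested_boxes (R : realType) (n : nat) (V : nat -> node R n) :
  (forall k l, `|(num (V k.+1) l)%:R / (den (V k.+1))%:R
                 - (num (V k) l)%:R / (den (V k))%:R| + rad (V k.+1)
               <= rad (V k)) ->
  exists xi, forall k, in_box (V k) xi.
Proof.
move=> nest.
pose c k l : R := (num (V k) l)%:R / (den (V k))%:R.
pose lo l k := c k l - rad (V k); pose hi l k := c k l + rad (V k).
have loS l : {homo lo l : j k / (j <= k)%N >-> j <= k}.
  apply: homo_leq le_trans _ => // k; have := nest k l.
  by rewrite -/(c k l) -/(c k.+1 l) /lo -lerBrDr ler_norml; lra.
have hiS l : {homo hi l : j k / (j <= k)%N >-> k <= j}.
  apply: homo_leq => [//|y x z xy yz|k]; first exact: le_trans yz xy.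
  have := nest k l.
  by rewrite -/(c k l) -/(c k.+1 l) /hi -lerBrDr ler_norml; lra.
have lohi l j k : lo l j <= hi l k.
  apply: le_trans (loS l _ _ (leq_maxl j k)) _.
  apply: le_trans _ (hiS l _ _ (leq_maxr j k)).
  by rewrite /lo /hi; have := rad_gt0 (V (maxn j k)); lra.
exists (\row_l sup (range (lo l))) => k l; rewrite mxE -/(c k l).
have : lo l k <= sup (range (lo l)).
  by apply: ub_le_sup; [exists (hi l 0%N) => _ [j _ <-]|exists k].
have : sup (range (lo l)) <= hi l k.
  by apply: ge_sup; [exists (lo l k); exists k|move=> _ [j _ <-]].
by rewrite /lo /hi ler_norml; lra.
Qed.

Lemma exists_bracket (d : nat -> nat) (k0 Q : nat) :
  (forall k, (d k < d k.+1)%N) -> (d k0 <= Q)%N ->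
  exists2 k, (k0 <= k)%N & (d k <= Q < d k.+1)%N.
Proof.
move=> dS dQ; have dk k : (k <= d k)%N.
  by elim: k => // k IH; apply: leq_ltn_trans IH (dS k).
have [|m Qm mmin] := ex_minnP (P := fun m => Q < d (k0 + m)%N)%N.
  by exists Q.+1; apply: leq_trans (dk _); rewrite leq_addl.
case: m => [|m] in Qm mmin *; first by move: Qm; rewrite addn0; lia.
exists (k0 + m)%N; first exact: leq_addr.
rewrite -addnS Qm andbT leqNgt; apply/negP => /mmin.
by rewrite ltnn.
Qed.

Lemma limn_esup_eq (R : realType) (u : nat -> R) (a : R) :
  (forall e, 0 < e -> exists N, forall Q, (N <= Q)%N -> u Q <= a + e) ->
  (forall e, 0 < e -> forall N, exists2 Q, (N <= Q)%N & a - e <= u Q) ->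
  limn_esup (fun Q => (u Q)%:E) = a%:E.
Proof.
move=> above below; rewrite limn_esup_lim; apply/eqP; rewrite eq_le.
apply/andP; split.
  apply/lee_addgt0Pr => e /above[N uN]; rewrite -EFinD.
  apply: lime_le; first exact: is_cvg_esups.
  near=> k; apply: ge_ereal_sup => _ [Q /= kQ <-]; rewrite lee_fin; apply: uN.
  by apply: leq_trans kQ; near: k; exact: nbhs_infty_ge.
apply/lee_subgt0Pr => e /below ub; rewrite -EFinB.
apply: lime_ge; first exact: is_cvg_esups.
apply: nearW => k; have [Q kQ uQ] := ub k.
apply: (@le_trans _ _ (u Q)%:E); first by rewrite lee_fin.
by apply: ereal_sup_ubound; exists Q.
Unshelve. all: by end_near. Qed.

(** The vanishing form is admissible for all large [Q], so [psi_dual] is eventually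
    zero. *)
Lemma dependent_limn_esup (R : realType) (n : nat) (xi : 'rV[R]_n)
    (Phi : nat -> R) : integrally_dependent xi ->
  limn_esup (fun Q : nat => (psi_dual xi Q%:R / Phi Q)%:E) = 0%:E.
Proof.
move=> [b b0 bxi].
pose N := (\sum_(l < n) absz (b 0 (lift ord0 l))%R)%N.
have psi0 Q : (N <= Q)%N -> psi_dual xi Q%:R = 0 :> R.
  move=> NQ; have [[c _ psiE] psi_le] := psi_dual_attained xi (ler0n R Q).
  apply/eqP; rewrite eq_le {2}psiE normr_ge0 andbT.
  have := psi_le b; rewrite bxi normr0; apply; apply/andP; split=> //.
  apply/forallP => l; rewrite -abszE -pmulrn ler_nat; apply: leq_trans NQ.
  by rewrite /N (bigD1 l)//= leq_addr.
apply: limn_esup_eq => e e0.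
  by exists N => Q /psi0 ->; rewrite mul0r add0r ltW.
move=> M; exists (maxn M N); first exact: leq_maxl.
by rewrite psi0 ?leq_maxr// mul0r; lra.
Qed.

(** The box of step [k.+1] is refined with tolerance [1 / (k + 1)] and away from
    [zeta k]. *)
Lemma exists_point_off_sequence (R : realType) (n : nat) (Phi : nat -> R)
    (zeta : nat -> 'rV[R]_n) : (2 <= n)%N ->
  (forall t : nat, (0 < t)%N -> 0 < Phi t) ->
  (exists t0 : nat, forall t : nat, (0 < t)%N -> (t0 <= t)%N ->
      Phi t < t%:R ^- n) ->
  exists xi : 'rV[R]_n,
    limn_esup (fun Q : nat => (psi_dual xi Q%:R / Phi Q)%:E) = 1%:E /\
    forall k, xi = zeta k -> integrally_dependent xi.
Proof.
move=> hn Phi_gt0 Phi_lt.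
have eps0 k : 0 < (k.+1%:R^-1 : R) by rewrite invr_gt0 ltr0n.
have eps1 k : (k.+1%:R^-1 : R) <= 1 by rewrite invf_le1 ?ltr0n// ler1n.
have [F FP] := choice (fun kv : nat * node R n =>
  refine kv.2 (zeta kv.1) hn Phi_gt0 Phi_lt (eps0 kv.1) (eps1 kv.1)).
have i0 : 'I_n by case: n hn {zeta Phi_lt F FP} => // m _; exact: ord0.
pose v0 := @Node R n 1 (fun=> 1%N) i0 1 1 1 isT (fun=> isT) isT erefl isT ltr01.
pose V := fix V k := if k is k'.+1 then F (k', V k') else v0.
have {FP} VP k := FP (k, V k).
have VS k : (rden (V k) < rden (V k.+1))%N by have [] := VP k.
have Vk k : (k <= rden (V k))%N.
  by elim: k => // k IH; apply: leq_ltn_trans IH (VS k).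
have [|xi xiV] := @nested_boxes R n V.
  by move=> k l; have [_ + _ _ _] := VP k; exact.
exists xi; split; last first.
  move=> k xik; rewrite xik; have [_ _ _ _] := VP k; apply.
  by rewrite -xik; exact: (xiV k.+1).
have smalleps e : 0 < e -> exists N, forall k, (N <= k)%N -> k.+1%:R^-1 <= e :> R.
  move=> e0; exists (Num.truncn e^-1) => k ek.
  rewrite -[leRHS]invrK lef_pV2 ?posrE ?ltr0n ?invr_gt0//.
  by apply: (le_trans (ltW (truncnS_gt _))); rewrite ler_nat ltnS.
apply: limn_esup_eq => e /smalleps[N eN].
  exists (rden (V N)) => Q NQ.
  have [k Nk kQ] := exists_bracket VS NQ.
  have Q0 : (0 < Q)%N by apply: leq_trans NQ; exact: rden_gt0.
  have [_ _ + _ _] := VP k => /(_ _ (xiV k.+1) _ kQ) psiQ.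
  rewrite ler_pdivrMr ?Phi_gt0//; apply: (le_trans psiQ).
  by rewrite ler_pM2r ?Phi_gt0// lerD2l eN.
move=> M; have [_ _ _ + _] := VP (maxn M N) => /(_ _ (xiV _.+1))[Q /andP[VQ _] psiQ].
have MQ : (maxn M N <= Q)%N := leq_trans (Vk _) VQ.
exists Q; first by apply: leq_trans MQ; exact: leq_maxl.
have Q0 : (0 < Q)%N by apply: leq_trans VQ; exact: rden_gt0.
rewrite ler_pdivlMr ?Phi_gt0//; apply: le_trans psiQ.
by rewrite ler_pM2r ?Phi_gt0// lerB// eN// leq_maxr.
Qed.

(** A countable solution set would be exhausted by a sequence; the solution which
    avoids this sequence would then be dependent. *)
Theorem theorem1p2 (R : realType) (n : nat) (hn : (2 <= n)%N) (Phi : nat -> R)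
    (Phi_gt0 : forall t : nat, (0 < t)%N -> 0 < Phi t)
    (Phi_lt : exists t0 : nat, forall t : nat, (0 < t)%N -> (t0 <= t)%N ->
      Phi t < t%:R ^- n)
    (Phi_liminf :
      (1%:E <= limf_einf
                 (fun alpha : R =>
                    limn_einf (fun t : nat =>
                      (Phi (Num.truncn (alpha * t%:R)) / Phi t)%:E))
                 (1 : R)^'+)%E) :
  ~ countable [set xi : 'rV[R]_n |
      limn_esup (fun Q : nat => (psi_dual xi Q%:R / Phi Q)%:E) = 1%:E].
Proof.
move=> /countable_injP[f finj].
set S := [set xi | _] in finj.
pose zeta k := xget 0 [set z | S z /\ f z = k].
have [xi [xiS avoid]] := exists_point_off_sequence zeta hn Phi_gt0 Phi_lt.
have xiz : xi = zeta (f xi).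
  rewrite /zeta; case: xgetP => [z _ [zS fz]|/(_ xi)]; last by case.
  by apply: finj; rewrite ?inE.
have := dependent_limn_esup Phi (avoid _ xiz).
by rewrite xiS => -[] /eqP; rewrite oner_eq0.
Qed.
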